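(* The monotone, tensor, free and Boolean cumulants $K_n^M,K_n^T,K_n^F,K_n^B$ satisfy the extensivity condition (MK3'): for each of these four notions of independence, with $K_n$ the corresponding cumulant and $N.X$ the corresponding dot operation, for every algebraic probability space $(\mathcal{A},\varphi)$, all $n\ge1$, all $X_1,\dots,X_n\in\mathcal{A}$ and all natural numbers $N\ge 0$, $$K_n(N.X_1,\dots,N.X_n)=N\,K_n(X_1,\dots,X_n).$$
   Context: An algebraic probability space $(\mathcal{A},\varphi)$ is a unital $*$-algebra $\mathcal{A}$ over $\mathbb{C}$ with a state $\varphi$. **Independence.** Let $\{\mathcal{A}_\lambda\}_{\lambda\in\Lambda}$ be $*$-subalgebras of $\mathcal{A}$. The rules below are required for all $n\ge2$ and all $X_i\in\mathcal{A}_{\lambda_i}$ ($1\le i\le n$) with $\lambda_i\ne\lambda_{i+1}$ for $1\le i\le n-1$. (1) Tensor: $\varphi(X_1\cdots X_n)=\prod_{\lambda\in\Lambda}\varphi\big(\overrightarrow{\prod}_{i;\,\lambda_i=\lambda}X_i\big)$, where $\overrightarrow{\prod}$ is the product in the same order as the factors appear in $X_1\cdots X_n$ (empty product $=1$). (2) Free (all $\mathcal{A}_\lambda$ are assumed to contain the unit of $\mathcal{A}$): $\varphi(X_1\cdots X_n)=0$ whenever $\varphi(X_1)=\cdots=\varphi(X_n)=0$. (3) Boolean: $\varphi(X_1\cdots X_n)=\varphi(X_1)\cdots\varphi(X_n)$. (4) Monotone ($\Lambda$ is linearly ordered by $<$): $\varphi(X_1\cdots X_i\cdots X_n)=\varphi(X_i)\varphi(X_1\cdots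 X_{i-1}X_{i+1}\cdots X_n)$ whenever $\lambda_{i-1}<\lambda_i$ and $\lambda_i>\lambda_{i+1}$ (one of the inequalities is dropped when $i=1$ or $i=n$). **Dot operation.** For a fixed notion of independence, take copies $\{X^{(j)}\}_{j\ge1}$ of every $X\in\mathcal{A}$ in an algebraic probability space $(\widetilde{\mathcal{A}},\widetilde\varphi)$ such that: $X\mapsto X^{(j)}$ is a $*$-homomorphism $\mathcal{A}\to\widetilde{\mathcal{A}}$ for each $j$; $\widetilde\varphi(X_1^{(j)}\cdots X_n^{(j)})=\varphi(X_1\cdots X_n)$ for all $X_i\in\mathcal{A}$, $j,n\ge1$; and the subalgebras $\mathcal{A}^{(j)}=\{X^{(j)}\}_{X\in\mathcal{A}}$, $j\ge1$ (index set with its natural order in the monotone case), are independent. Such copies always exist. Put $N.X=X^{(1)}+\cdots+X^{(N)}$ for integers $N\ge0$, with $0.X=0$. One writes $\varphi$ for $\widetilde\varphi$. **Cumulants.** $\varphi(N.X_1\cdots N.X_n)$ is a polynomial in $N$ (with coefficients polynomial in the joint moments of the $X_i$) without constant term. $K_n^M$ (resp. $K_n^T,K_n^F,K_n^B$) evaluated at $(X_1,\dots,X_n)$ is defined as the coefficient of $N$ (linear coefficient) in $\varphi(N.X_1\cdots N.X_n)$ for monotone (resp. tensor, free, Boolean) independence. The quantity $K_n(N.X_1,\dots,N.X_n)$ is the cumulant computed in $(\widetilde{\mathcal{A}},\widetilde\varphi)$. *)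

(* Defs.v *)
From HB Require Import structures.
From mathcomp Require Import all_boot all_order all_algebra.
From mathcomp Require Import boolp classical_sets.

Set Implicit Arguments.
Unset Strict Implicit.
Unset Printing Implicit Defensive.

Import Order.TTheory GRing.Theory Num.Theory.

Local Open Scope ring_scope.

HB.mixin Record Algebra_hasStar (C : numClosedFieldType) A
    of GRing.Algebra C A := {
  star : A -> A;
  starK : involutive star;
  starD : {morph star : x y / x + y};
  starZ : forall (a : C) (x : A), star (a *: x) = a^* *: star x;
  starM : forall x y : A, star (x * y) = star y * star x
}.

#[short(type="starAlgType")]
HB.structure Definition StarAlgebra (C : numClosedFieldType) :=
  { A of GRing.Algebra C A & Algebra_hasStar C A }.

Record algProbSpace (C : numClosedFieldType) := AlgProbSpace {
  space :> starAlgType C;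
  state : {scalar space};
  state1 : state 1 = 1;
  state_ge0 : forall x : space, 0 <= state (star x * x)
}.

(* A *-homomorphism need not preserve the unit; for Boolean and monotone
   copies it cannot in general. *)
Definition star_hom (C : numClosedFieldType) (A B : starAlgType C)
    (f : A -> B) : Prop :=
  [/\ linear f, {morph f : x y / x * y} & {morph f : x / star x}].

Section Independence.
Variables (C : numClosedFieldType) (P : algProbSpace C).

(* The families B below are meant to consist of *-subalgebras of P; they are
   only ever instantiated with the ranges of *-homomorphisms. *)

(* Factors X_i taken from B (lam i), consecutive indices being different. *)
Definition alternating (L : eqType) (B : L -> set P) (n : nat)
    (lam : 'I_n -> L) (X : 'I_n -> P) : Prop :=
  (forall i, B (lam i) (X i)) /\
  (forall i j : 'I_n, j = i.+1 :> nat -> lam i <> lam j).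

(* The product over all indices of L reduces to those occurring in lam:
   the others contribute state 1 = 1. *)
Definition tensor_independent (L : eqType) (B : L -> set P) : Prop :=
  forall (n : nat) (lam : 'I_n -> L) (X : 'I_n -> P),
    (2 <= n)%N -> alternating B lam X ->
    state P (\prod_i X i) =
      \prod_(l <- undup (codom lam)) state P (\prod_(i | lam i == l) X i).

Definition free_independent (L : eqType) (B : L -> set P) : Prop :=
  (forall l, B l 1) /\
  forall (n : nat) (lam : 'I_n -> L) (X : 'I_n -> P),
    (2 <= n)%N -> alternating B lam X ->
    (forall i, state P (X i) = 0) -> state P (\prod_i X i) = 0.

Definition boolean_independent (L : eqType) (B : L -> set P) : Prop :=
  forall (n : nat) (lam : 'I_n -> L) (X : 'I_n -> P),
    (2 <= n)%N -> alternating B lam X ->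
    state P (\prod_i X i) = \prod_i state P (X i).

(* A neighbour that does not exist (i first or last) imposes no condition. *)
Definition monotone_independent d (L : orderType d) (B : L -> set P) : Prop :=
  forall (n : nat) (lam : 'I_n -> L) (X : 'I_n -> P),
    (2 <= n)%N -> alternating B lam X ->
    forall i : 'I_n,
      (forall j : 'I_n, i = j.+1 :> nat -> (lam j < lam i)%O) ->
      (forall j : 'I_n, j = i.+1 :> nat -> (lam j < lam i)%O) ->
      state P (\prod_j X j) = state P (X i) * state P (\prod_(j | j != i) X j).

End Independence.

Inductive independence := Tensor | Free | Boolean | Monotone.

Definition independent (C : numClosedFieldType) (P : algProbSpace C) (k : independence)
    d (L : orderType d) (B : L -> set P) : Prop :=
  match k with
  | Tensor => tensor_independent B
  | Free => free_independent B
  | Boolean => boolean_independent B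
  | Monotone => monotone_independent B
  end.

(* Copies are numbered from 0: copy j X is the (j+1)-st copy of X. *)
Record copies (C : numClosedFieldType) (k : independence) (P : algProbSpace C) := Copies {
  copy_space : algProbSpace C;
  copy : nat -> P -> copy_space;
  copy_star_hom : forall j, star_hom (copy j);
  copy_moment : forall (j n : nat) (X : 'I_n -> P), (1 <= n)%N ->
    state copy_space (\prod_i copy j (X i)) = state P (\prod_i X i);
  copy_independent : independent k (fun j : nat => range (copy j))
}.

Section Cumulants.
Variables (C : numClosedFieldType) (k : independence) (P : algProbSpace C).
Variable c : copies k P.

Definition dot (N : nat) (X : P) : copy_space c := \sum_(j < N) copy c j X.

Definition dot_moment (n : nat) (X : 'I_n -> P) (N : nat) : C :=
  state (copy_space c) (\prod_i dot N (X i)).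

Definition dot_moment_poly (n : nat) (X : 'I_n -> P) : set {poly C} :=
  [set p | forall N : nat, dot_moment X N = p.[N%:R]].

Lemma dot_moment_poly_uniq (n : nat) (X : 'I_n -> P) (p q : {poly C}) :
  dot_moment_poly X p -> dot_moment_poly X q -> p = q.
Proof.
move=> pX qX; apply/eqP; rewrite -subr_eq0; apply/negPn/negP => pq0.
pose s : seq C := [seq m%:R | m <- iota 0 (size (p - q))].
have := @max_poly_roots _ (p - q) s pq0; rewrite size_map size_iota ltnn.
suff [-> ->] : all (root (p - q)) s /\ uniq s by move=> /(_ isT isT).
split; last by rewrite map_inj_uniq ?iota_uniq//; exact: mulrIn (oner_neq0 _).
by apply/allP => _ /mapP[m _ ->]; rewrite rootE !hornerE -pX -qX subrr.
Qed.

(* By dot_moment_poly_uniq, the default polynomial 0 is returned only when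
   dot_moment X is not polynomial in N. *)
Definition cumulant (n : nat) (X : 'I_n -> P) : C :=
  (xget 0 (dot_moment_poly X))`_1.

Lemma cumulantE (n : nat) (X : 'I_n -> P) (p : {poly C}) :
  dot_moment_poly X p -> cumulant X = p`_1.
Proof.
move=> pX; rewrite /cumulant; case: xgetP => [q _ qX|/(_ p)//].
by rewrite (dot_moment_poly_uniq qX pX).
Qed.

End Cumulants.

(* Main.v *)
Require Import Defs.
From HB Require Import structures.
From mathcomp Require Import all_boot all_order all_algebra.
From mathcomp Require Import boolp classical_sets reals.
From mathcomp Require Import complex.

Set Implicit Arguments.
Unset Strict Implicit.
Unset Printing Implicit Defensive.

Import Order.TTheory GRing.Theory Num.Theory.

Local Open Scope ring_scope.

(* Each of the four rules determines every mixed moment of a family of copies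
   from the moments of P and the relative order of the labels of the letters.
   Hence a summand phi(X_1^(j_1) ... X_n^(j_n)) of the N-fold dot moment depends
   only on the order type of j, and grouping the j by their image turns the dot
   moment into a combination of the binomials C(N, m), m <= n: it is a polynomial
   p in N.  The four independences are associative, so the copies of the copies,
   enumerated lexicographically, are again independent copies of P, and
   M.(N.X) has the same joint moments as (MN).X.  These moments are p(NM), whose
   coefficient of M is N p_1. *)

(** * Alternating words and the merging of neighbours *)

Definition alternate (I : eqType) (T : Type) (w : seq (I * T)) : bool :=
  sorted (fun y z => y.1 != z.1) w.

Lemma nonalternate_split (I : eqType) (T : Type) (w : seq (I * T)) :
  ~~ alternate w -> exists s l x y t, w = s ++ (l, x) :: (l, y) :: t.
Proof.
elim: w => [|[l x] [|[m y] t] IH] //; rewrite /alternate /= negb_and negbK.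
case: (l =P m) => [<- _|_ /IH [s [l' [x' [y' [t' ->]]]]]].
  by exists [::], l, x, y, t.
by exists ((l, x) :: s), l', x', y', t'.
Qed.

Lemma alternate_catr (I : eqType) (T : Type) (u v : seq (I * T)) :
  alternate (u ++ v) -> alternate v.
Proof.
by rewrite /alternate; case: u => //= a u; rewrite cat_path => /andP[_ /path_sorted].
Qed.

Lemma alternate_catl (I : eqType) (T : Type) (u v : seq (I * T)) :
  alternate (u ++ v) -> alternate u.
Proof. by rewrite /alternate; case: u => //= a u; rewrite cat_path => /andP[]. Qed.

(** A word that does not alternate has two neighbours with one label, and multiplying them shortens
    it. Hence a property invariant under merging only has to be checked on alternating words, where
    the rules apply. *)
Lemma merge_ind (I : eqType) (T : pzSemiRingType) (Pr : seq (I * T) -> Prop) :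
  (forall w, alternate w -> Pr w) ->
  (forall s l x y t,
     Pr (s ++ (l, x * y) :: t) -> Pr (s ++ (l, x) :: (l, y) :: t)) ->
  forall w, Pr w.
Proof.
move=> altP mergeP w; have [n] := ubnP (size w).
elim: n w => // n IH w; have [/altP//|/nonalternate_split] := boolP (alternate w).
move=> [s [l [x [y [t ->]]]]]; rewrite size_cat /= !addnS ltnS => sz.
by apply/mergeP/IH; rewrite size_cat /= addnS.
Qed.

(** Both products reduce to the labels common to [s] and [t]. This lets the list of labels in the
    tensor rule be changed at will. *)
Lemma prod_seq_support (T : eqType) (C : comPzSemiRingType) (s t : seq T) (F : T -> C) :
  uniq s -> uniq t -> (forall l, l \notin s -> F l = 1) ->
  (forall l, l \notin t -> F l = 1) ->
  \prod_(l <- s) F l = \prod_(l <- t) F l.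
Proof.
move=> us ut s1 t1.
have H (r r' : seq T) : (forall l, l \notin r' -> F l = 1) ->
    \prod_(l <- r) F l = \prod_(l <- [seq x <- r | x \in r']) F l.
  move=> r1; rewrite big_filter [RHS]big_mkcond; apply: eq_bigr => l _.
  by case: ifPn => // /r1.
rewrite (H s t)// (H t s)//; apply: perm_big; apply: uniq_perm.
- exact: filter_uniq.
- exact: filter_uniq.
- by move=> l; rewrite !mem_filter andbC.
Qed.

(** * The four rules restated for words of labelled letters *)

Section Words.
Variables (C : numClosedFieldType) (P Q : algProbSpace C).

Definition wordval (I : Type) (f : I -> P -> Q) (w : seq (I * P)) : Q :=
  \prod_(z <- w) f z.1 z.2.

(** The part of being a copy that does not involve independence. Asking for the moments of single
    letters suffices, because each [f l] is multiplicative. *)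
Definition moment_hom (I : Type) (f : I -> P -> Q) : Prop :=
  (forall l, star_hom (f l)) /\ (forall l x, state Q (f l x) = state P x).

Section Eq.
Variable I : eqType.
Implicit Types (f : I -> P -> Q) (w : seq (I * P)).

Definition tensor_words f : Prop := forall w (s : seq I),
  alternate w -> uniq s -> {subset [seq z.1 | z <- w] <= s} ->
  state Q (wordval f w) = \prod_(l <- s) state P (\prod_(z <- w | z.1 == l) z.2).

Definition free_words f : Prop :=
  (forall l, f l 1 = 1) /\
  forall w, alternate w -> w <> [::] ->
    (forall z, z \in w -> state P z.2 = 0) -> state Q (wordval f w) = 0.

Definition boolean_words f : Prop := forall w,
  alternate w -> state Q (wordval f w) = \prod_(z <- w) state P z.2.

End Eq.

(* Only peaks of maximal index are removed. They suffice to compute every moment,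
   and, unlike arbitrary peaks, they are easily seen to be removable in a nested
   family, where a peak can lie in the middle of a run of letters belonging to
   the same outer copy. *)
Definition monotone_words d (I : orderType d) (f : I -> P -> Q) : Prop :=
  forall u l x v, alternate (u ++ (l, x) :: v) ->
    all (fun z => (z.1 <= l)%O) (u ++ v) ->
    state Q (wordval f (u ++ (l, x) :: v)) =
      state P x * state Q (wordval f (u ++ v)).

Definition words_independent (k : independence) d (I : orderType d) (f : I -> P -> Q) : Prop :=
  match k with
  | Tensor => tensor_words f
  | Free => free_words f
  | Boolean => boolean_words f
  | Monotone => monotone_words f
  end.

Lemma wordval_cat (I : Type) (f : I -> P -> Q) u v :
  wordval f (u ++ v) = wordval f u * wordval f v.
Proof. exact: big_cat. Qed.

Lemma wordval_cons (I : Type) (f : I -> P -> Q) z v :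
  wordval f (z :: v) = f z.1 z.2 * wordval f v.
Proof. exact: big_cons. Qed.

Lemma wordval_nil (I : Type) (f : I -> P -> Q) : wordval f [::] = 1.
Proof. exact: big_nil. Qed.

Lemma moment_homM (I : Type) (f : I -> P -> Q) : moment_hom f ->
  forall l, {morph f l : x y / x * y}.
Proof. by move=> [+ _] l => /(_ l)[]. Qed.

Lemma moment_homB (I : Type) (f : I -> P -> Q) : moment_hom f ->
  forall l a x y, f l (a *: x + y) = a *: f l x + f l y.
Proof. by move=> [+ _] l a x y => /(_ l)[+ _ _] => ->. Qed.

Lemma wordval_merge (I : Type) (f : I -> P -> Q) : moment_hom f ->
  forall s l x y t, wordval f (s ++ (l, x) :: (l, y) :: t) = wordval f (s ++ (l, x * y) :: t).
Proof.
by move=> fh s l x y t; rewrite !wordval_cat !wordval_cons /= moment_homM// !mulrA.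
Qed.

(** The product is kept nonempty because [f l] may fail to preserve 1. *)
Lemma moment_hom_prod (I : Type) (f : I -> P -> Q) : moment_hom f ->
  forall l (x : P) r, \prod_(y <- x :: r) f l y = f l (\prod_(y <- x :: r) y).
Proof.
move=> fh l x r; elim: r x => [|y r IH] x; first by rewrite !big_seq1.
by rewrite big_cons IH -moment_homM// [in RHS]big_cons.
Qed.

Lemma state_prod_same (I : Type) (f : I -> P -> Q) : moment_hom f ->
  forall l r, state Q (\prod_(y <- r) f l y) = state P (\prod_(y <- r) y).
Proof.
move=> fh l [|x r]; first by rewrite !big_nil !state1.
by rewrite moment_hom_prod//; case: fh => _ ->.
Qed.

Lemma tensor_words_gen (I : eqType) (f : I -> P -> Q) : moment_hom f ->
  tensor_words f -> forall w (s : seq I),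
  uniq s -> {subset [seq z.1 | z <- w] <= s} ->
  state Q (wordval f w) = \prod_(l <- s) state P (\prod_(z <- w | z.1 == l) z.2).
Proof.
move=> fh tf w s us; elim/(@merge_ind I P): w => [w aw sub|w l x y t IH sub]; first exact: tf.
rewrite wordval_merge// IH => [|m]; last first.
  move=> hm; apply: sub; move: hm; rewrite !map_cat !mem_cat /= !inE.
  by case/or3P => ->; rewrite ?orbT.
apply: eq_bigr => m _; congr (state P _).
rewrite !big_cat !big_cons /=; by case: (l == m); rewrite ?mulrA.
Qed.

(** Letters are merged first inside [u], then inside [v], until both alternate. The strict
    inequalities at the ends of [u] and [v] survive merging and make the whole word alternate around
    the peak. *)
Lemma monotone_words_gen d (I : orderType d) (f : I -> P -> Q) : moment_hom f ->
  monotone_words f -> forall u l x v,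
    all (fun z => (z.1 <= l)%O) (u ++ v) ->
    last true [seq (z.1 < l)%O | z <- u] -> head true [seq (z.1 < l)%O | z <- v] ->
    state Q (wordval f (u ++ (l, x) :: v)) = state P x * state Q (wordval f (u ++ v)).
Proof.
move=> fh mf u l x v; elim/(@merge_ind I P): u v => [u au|s m y z t IH]; last first.
  move=> v allv lastv headv.
  rewrite -!catA !cat_cons !wordval_merge// -!cat_cons !catA IH//.
    by move: allv; rewrite !all_cat /= => /andP[/and4P[-> -> _ ->] ->].
  by move: lastv; rewrite !map_cat !last_cat.
elim/(@merge_ind I P) => [v av|s m y z t IH]; last first.
  move=> allv lastv headv.
  rewrite -cat_cons !catA !wordval_merge// -!catA IH//.
    by move: allv; rewrite !all_cat /= => /and5P[-> -> -> _ ->].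
  by move: headv; case: (s).
move=> allv lastv headv; apply: mf => //.
rewrite /alternate; case: u au lastv {allv} => [_ _|[m y] u] /=.
  by case: v av headv => //= -[m y] v av ml; rewrite av andbT /= eq_sym lt_eqF.
rewrite cat_path => au lastv; apply/andP; split; first exact: au.
rewrite /= (last_map (fun z : I * P => (z.1 < l)%O) u (m, y)) in lastv *.
apply/andP; split; first by rewrite lt_eqF.
by case: v av headv => //= -[m' y'] v av ml; rewrite av andbT /= eq_sym lt_eqF.
Qed.

(** Write x as its centred part plus a multiple of 1; since [f l 1 = 1], the second summand deletes
    the letter. *)
Lemma state_wordval_centre (I : Type) (f : I -> P -> Q) : moment_hom f ->
  (forall l, f l 1 = 1) -> forall s l x t,
  let a := state P x in
  state Q (wordval f (s ++ (l, x) :: t)) =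
  state Q (wordval f (s ++ (l, x - a *: 1) :: t)) + a * state Q (wordval f (s ++ t)).
Proof.
move=> fh f1 s l x t a.
rewrite !wordval_cat !wordval_cons /=.
have -> : x - a *: 1 = (- a) *: 1 + x by rewrite scaleNr addrC.
rewrite moment_homB// f1 -linearZ -linearD; congr (state Q _).
rewrite mulrDl mulrDr addrAC -[LHS]add0r; congr (_ + _).
by rewrite -!scalerAl mul1r -scalerAr scaleNr addNr.
Qed.

End Words.

(** * Each rule determines all mixed moments *)

Section Unique.
Variables (C : numClosedFieldType) (P Q Q' : algProbSpace C).

Lemma state_wordval_merge (I : Type) (f : I -> P -> Q) (g : I -> P -> Q') :
  moment_hom f -> moment_hom g -> forall s l x y t,
  state Q (wordval f (s ++ (l, x * y) :: t)) = state Q' (wordval g (s ++ (l, x * y) :: t)) ->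
  state Q (wordval f (s ++ (l, x) :: (l, y) :: t)) =
  state Q' (wordval g (s ++ (l, x) :: (l, y) :: t)).
Proof. by move=> fh gh s l x y t; rewrite !wordval_merge. Qed.

(** Induction on length. The letters of an alternating word are centred one by one from the left;
    each centring costs a term with a shorter word, and the fully centred word has state 0 on both
    sides. *)
Lemma free_words_unique (I : eqType) (f : I -> P -> Q) (g : I -> P -> Q') :
  moment_hom f -> moment_hom g -> free_words f -> free_words g ->
  forall w, state Q (wordval f w) = state Q' (wordval g w).
Proof.
move=> fh gh [f1 ff] [g1 fg] w; have [n] := ubnP (size w).
elim: n w => // n IH w; rewrite ltnS => wn.
have [aw|/nonalternate_split] := boolP (alternate w); last first.
  move=> [s [l [x [y [t wE]]]]]; rewrite wE; apply: state_wordval_merge => //.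
  by apply: IH; rewrite (leq_trans _ wn)// wE !size_cat /= !addnS.
(* [s] is the prefix already centred and [t] the part still to be treated. *)
suff H t s : (forall z, z \in s -> state P z.2 = 0) -> alternate (s ++ t) ->
    (size (s ++ t) <= n)%N ->
    state Q (wordval f (s ++ t)) = state Q' (wordval g (s ++ t)).
  exact: (H w [::]).
elim: t s => [|[l x] t IHt] s s0.
  case: s s0 => [|a s] s0; first by rewrite !wordval_nil !state1.
  by rewrite cats0 => aw' _; rewrite ff// fg.
move=> ast sz; rewrite (state_wordval_centre fh)// (state_wordval_centre gh)//.
congr (_ + _ * _); last by apply: IH; rewrite (leq_trans _ sz)// !size_cat /= addnS.
rewrite -!cat_rcons; apply: IHt.
- move=> z; rewrite mem_rcons inE => /orP[/eqP -> /=|/s0//].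
  by rewrite linearB linearZ /= state1 mulr1 subrr.
- rewrite cat_rcons; move: ast; rewrite /alternate.
  by case: (s) => [|b r] /=; rewrite ?cat_path//=; case: (t).
- by move: sz; rewrite cat_rcons !size_cat.
Qed.

Lemma max_split d (I : orderType d) (T : Type) (w : seq (I * T)) : w <> [::] ->
  exists u l x v, w = u ++ (l, x) :: v /\ all (fun z => (z.1 <= l)%O) (u ++ v).
Proof.
elim: w => // -[l x] [|z w] IH _; first by exists [::], l, x, [::].
have [//|u [m [y [v [-> H]]]]] := IH; have [lm|ml] := leP l m.
  by exists ((l, x) :: u), m, y, v; split=> //=; rewrite lm.
exists [::], l, x, (u ++ (m, y) :: v); split=> //=.
move: H; rewrite !all_cat /= (ltW ml) /= => /andP[Hu Hv].
have le_l : subpred (fun z : I * T => (z.1 <= m)%O) (fun z => (z.1 <= l)%O).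
  by move=> a /le_trans; apply; exact: ltW.
by rewrite (sub_all le_l Hu) (sub_all le_l Hv).
Qed.

(** In an alternating word a letter of maximal label can be split off by the rule on both sides,
    leaving the same shorter word. *)
Lemma monotone_words_unique d (I : orderType d) (f : I -> P -> Q) (g : I -> P -> Q') :
  moment_hom f -> moment_hom g -> monotone_words f -> monotone_words g ->
  forall w, state Q (wordval f w) = state Q' (wordval g w).
Proof.
move=> fh gh mf mg w; have [n] := ubnP (size w).
elim: n w => // n IH w; rewrite ltnS => wn.
have [aw|/nonalternate_split] := boolP (alternate w); last first.
  move=> [s [l [x [y [t wE]]]]]; rewrite wE; apply: state_wordval_merge => //.
  by apply: IH; rewrite (leq_trans _ wn)// wE !size_cat /= !addnS.
have [w0|/eqP/max_split] := eqVneq w [::]; first by rewrite w0 !wordval_nil !state1.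
move=> [u [l [x [v [wE allw]]]]]; rewrite wE in aw wn *.
rewrite mf// mg// IH// (leq_trans _ wn)//.
by rewrite !size_cat /= addnS.
Qed.

(** The tensor and Boolean rules evaluate alternating words outright in moments of [P], and merging
    reaches all others; the free and monotone rules only give recursions on length. *)
Lemma words_independent_unique k d (I : orderType d) (f : I -> P -> Q) (g : I -> P -> Q') :
  moment_hom f -> moment_hom g -> words_independent k f -> words_independent k g ->
  forall w, state Q (wordval f w) = state Q' (wordval g w).
Proof.
case: k => /= fh gh.
- move=> tf tg; elim/(@merge_ind I P) => [w aw|]; last exact: state_wordval_merge.
  pose s := undup [seq z.1 | z <- w].
  have us : uniq s by exact: undup_uniq.
  have ws : {subset [seq z.1 | z <- w] <= s} by move=> l; rewrite mem_undup.
  by rewrite (tf w s)// (tg w s).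
- exact: free_words_unique.
- move=> bf bg; elim/(@merge_ind I P) => [w aw|]; last exact: state_wordval_merge.
  by rewrite bf// bg.
- exact: monotone_words_unique.
Qed.

End Unique.

(** An order embedding of the labels preserves alternation, the classes of equal labels and
    maximality of a label, so each rule is carried along. *)
Lemma words_independent_pullback (C : numClosedFieldType) (P Q : algProbSpace C) k
    d (I : orderType d) d' (J : orderType d') (h : J -> I) (f : I -> P -> Q) :
  {mono h : i j / (i <= j)%O} ->
  words_independent k f -> words_independent k (fun j => f (h j)).
Proof.
move=> hm; have hi := inc_inj hm.
pose H (w : seq (J * P)) := [seq (h z.1, z.2) | z <- w].
have HE w : wordval (fun j => f (h j)) w = wordval f (H w).
  by rewrite /wordval big_map.
have Ha w : alternate (H w) = alternate w.
  rewrite /alternate /H sorted_map; apply: eq_sorted => y z /=.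
  by rewrite (inj_eq hi).
case: k => /=.
- move=> tf w s aw us sub; rewrite HE (tf _ (map h s)) ?Ha ?map_inj_uniq//.
    rewrite big_map; apply: eq_bigr => l _; rewrite big_map.
    by congr (state P _); apply: eq_bigl => z /=; rewrite (inj_eq hi).
  move=> l; rewrite -map_comp => /mapP[z zw ->] /=.
  by apply: map_f; apply: sub; apply: map_f.
- move=> [f1 ff]; split=> // w aw w0 wc; rewrite HE ff ?Ha//; first by case: w w0 {aw wc}.
  by move=> _ /mapP[z zw ->]; exact: wc.
- by move=> bf w aw; rewrite HE bf ?Ha// big_map.
- move=> mf u l x v aw allw; rewrite !HE /H !map_cat /= mf.
  + by [].
  + by rewrite -[X in alternate X](map_cat _ u ((l, x) :: v)) Ha.
  + by rewrite -map_cat all_map; apply: sub_all allw => z /=; rewrite hm.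
Qed.

(** * From the definition of copies to the rules for words *)

Lemma prod_ord_skip (R : pzSemiRingType) (T : Type) (a : T) (u v : seq T) (x : T)
    (F : T -> R) :
  \prod_(j < size (u ++ x :: v) | val j != size u) F (nth a (u ++ x :: v) j) =
  \prod_(z <- u ++ v) F z.
Proof.
rewrite -(big_mkord (fun j => j != size u) (fun j => F (nth a (u ++ x :: v) j))).
rewrite (@big_cat_nat _ _ _ (size u)) ?size_cat ?leq_addr//=.
have su: (size u < size u + (size v).+1)%N by rewrite addnS ltnS leq_addr.
rewrite (big_ltn_cond su).
rewrite eqxx big_cat /=; congr (_ * _).
  rewrite (big_nth a) big_nat_cond [RHS]big_nat_cond.
  apply: eq_big => [j|j /andP[/andP[_ ju] _]]; last by rewrite nth_cat ju.
  by rewrite andbT; case: ltngtP; rewrite ?andbF.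
rewrite -[X in \big[_/_]_(X <= _ < _ | _) _]add0n big_addn addnS -addSn addKn.
rewrite (big_nth a) big_mkcond; apply: eq_bigr => j _.
rewrite nth_cat ltnNge addnS leqW ?leq_addl //= -addSn addnK /=.
by rewrite -[X in _ != X]add0n eqn_add2r.
Qed.

Section FromCopies.
Variables (C : numClosedFieldType) (P : algProbSpace C).

Lemma copy_moment_hom k (c : copies k P) : moment_hom (copy c).
Proof.
split=> [l|l x]; first exact: copy_star_hom.
by have := @copy_moment _ _ _ c l 1 (fun=> x) isT; rewrite !big_ord1.
Qed.

Lemma alternating_word k (c : copies k P) (a : nat * P) (w : seq (nat * P)) : alternate w ->
  alternating (fun j => range (copy c j)) (fun i : 'I_(size w) => (nth a w i).1)
    (fun i => copy c (nth a w i).1 (nth a w i).2).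
Proof.
move=> aw; split=> [i|i j ji]; first by exists (nth a w i).2.
by apply/eqP; move/(sortedP a): aw => /(_ i); rewrite ji; apply; rewrite -ji.
Qed.

Lemma prod_word k (c : copies k P) (a : nat * P) (w : seq (nat * P)) :
  \prod_(i < size w) copy c (nth a w i).1 (nth a w i).2 = wordval (copy c) w.
Proof. by rewrite /wordval (big_nth a) big_mkord. Qed.

(** The defining rules speak of at least two factors; words with at most one letter are settled by
    [state1] and the moments of a single copy. *)
Lemma copies_words_independent k (c : copies k P) : words_independent k (copy c).
Proof.
have ch := copy_moment_hom c; have ci := copy_independent c.
have cE l x : state (copy_space c) (copy c l x) = state P x by case: ch => _ ->.
have aA := @alternating_word _ c; have pw := @prod_word _ c.
case: k c ch ci cE aA pw => /= c ch ci cE aA pw.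
- move=> w s aw us sub.
  have supp l : l \notin s -> state P (\prod_(z <- w | z.1 == l) z.2) = 1.
    move=> ls; rewrite big1_seq ?state1// => z /andP[/eqP zl zw].
    by rewrite -zl sub ?map_f in ls.
  case: w aw sub supp => [|a [|b w]] aw sub supp.
  + by rewrite wordval_nil state1 big1// => l _; rewrite big_nil state1.
  + rewrite wordval_cons wordval_nil mulr1 cE.
    rewrite (@prod_seq_support _ _ s [:: a.1])// ?big_seq1.
      by rewrite big_cons big_nil eqxx mulr1.
    by move=> l; rewrite inE big_cons big_nil eq_sym => /negbTE ->; rewrite state1.
  + set w' := a :: b :: w in aw sub supp *.
    rewrite -(pw a) (ci _ _ _ _ (aA a _ aw))//.
    rewrite (@prod_seq_support _ _ s (undup (codom (fun i : 'I_(size w') => (nth a w' i).1))))//.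
    * apply: eq_bigr => l _.
      transitivity (state (copy_space c) (\prod_(y <- [seq z.2 | z <- w' & z.1 == l]) copy c l y)).
        congr (state _ _); rewrite big_map big_filter (big_nth a) big_mkord.
        by apply: eq_bigr => i /eqP ->.
      by rewrite state_prod_same// big_map big_filter.
    * exact: undup_uniq.
    * move=> l; rewrite mem_undup => lc; rewrite big1_seq ?state1// => z /andP[/eqP zl zw].
      move: lc; rewrite -zl => /negP[]; apply/codomP.
      by have zi := zw; rewrite -index_mem in zi; exists (Ordinal zi); rewrite /= nth_index.
(* The unit lies in the range, say as the copy of [e]; multiplying the copy of 1 by it gives the
   copy of [e] again. *)
- have f1 l : copy c l 1 = 1.
    case: ci => /(_ l)[e _ el] _.
    by rewrite -[LHS]mulr1 -el -(moment_homM ch) mul1r.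
  split=> // -[|a [|b w]] aw // _ w0.
    by rewrite wordval_cons wordval_nil mulr1 cE w0 ?mem_head.
  rewrite -(pw a); case: ci => _ ci; rewrite (ci _ _ _ _ (aA a _ aw))// => i.
  by rewrite cE w0// mem_nth.
- move=> [|a [|b w]] aw; first by rewrite wordval_nil state1 big_nil.
    by rewrite wordval_cons wordval_nil mulr1 cE big_seq1.
  rewrite -(pw a) (ci _ _ _ _ (aA a _ aw))// (big_nth a) big_mkord.
  by apply: eq_bigr => i _; rewrite cE.
- move=> u l x v aw allw; set w := u ++ (l, x) :: v in aw *.
  have [|uv0] := eqVneq (u ++ v) [::].
    move=> uv; rewrite /w; case: (u) (v) uv => [|? ?] [|? ?] // _.
    by rewrite wordval_cons wordval_nil state1 !mulr1 cE.
  have wl : (size w = (size (u ++ v)).+1)%N by rewrite !size_cat /= addnS.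
  have iw : (size u < size w)%N by rewrite wl ltnS size_cat leq_addr.
  pose i := Ordinal iw; pose a := (l, x).
  have ni : nth a w i = (l, x) by rewrite nth_cat ltnn subnn.
  (* Maximality bounds every other label by [l]; for the two neighbours alternation then makes the
     inequality strict, so the letter is a peak. *)
  have le_l j : j != size u -> (j < size w)%N -> ((nth a w j).1 <= l)%O.
    move=> ju jw; rewrite nth_cat; case: ltnP => [{}ju|uj].
      by apply: (allP allw); rewrite mem_cat mem_nth.
    move: ju uj jw; rewrite wl size_cat neq_ltn ltnNge => /orP[/negP//|ju] _.
    rewrite -subn_gt0 in ju; rewrite -(prednK ju) => jv.
    apply: (allP allw); rewrite mem_cat /= mem_nth ?orbT//.
    by rewrite prednK// leq_subLR -ltnS.
  rewrite -(pw a) (ci _ _ _ _ (aA a _ aw) i).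
  + rewrite ni cE; congr (_ * state _ _).
    exact: (prod_ord_skip a u v (l, x) (fun z => copy c z.1 z.2)).
  + by rewrite wl ltnS lt0n size_eq0.
  + move=> j ij; rewrite ni lt_neqAle le_l //.
      move/(sortedP a): aw => /(_ j); rewrite -ij ni andbT; exact.
    by rewrite neq_ltn [val i]/= in ij *; rewrite ij ltnSn.
  + move=> j ij; rewrite ni lt_neqAle le_l //.
      move/(sortedP a): aw => /(_ i); rewrite -ij ni andbT eq_sym; exact.
    by rewrite ij /= neq_ltn ltnSn orbT.
Qed.
End FromCopies.

(** * Associativity: copies of copies obey the same rule *)

Lemma span_prefix (T : Type) (p : pred T) (v : seq T) :
  exists v1 v2, [/\ v = v1 ++ v2, all p v1 & head true [seq ~~ p z | z <- v2]].
Proof.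
elim: v => [|z v [v1 [v2 [-> pv1 hv2]]]]; first by exists [::], [::].
have [pz|npz] := boolP (p z); first by exists (z :: v1), v2; rewrite /= pz.
by exists [::], (z :: v1 ++ v2).
Qed.

Lemma span_suffix (T : Type) (p : pred T) (v : seq T) :
  exists v1 v2, [/\ v = v1 ++ v2, all p v2 & last true [seq ~~ p z | z <- v1]].
Proof.
elim/last_ind: v => [|v z [v1 [v2 [-> pv2 hv1]]]]; first by exists [::], [::].
have [pz|npz] := boolP (p z).
  by exists v1, (rcons v2 z); rewrite rcons_cat all_rcons pz.
by exists (rcons (v1 ++ v2) z), [::]; rewrite cats0 map_rcons last_rcons.
Qed.

Section Associativity.
Variables (C : numClosedFieldType) (P Q R : algProbSpace C).
Variables (f : nat -> P -> Q) (g : nat -> Q -> R) (N : nat).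
Hypotheses (fh : moment_hom f) (gh : moment_hom g) (N_gt0 : (0 < N)%N).

(* Ordering nat by j |-> (j %/ N, j %% N) lexicographically is the usual order,
   so the N copies inside each outer copy are numbered consecutively. *)
Definition nested (j : nat) (x : P) : R := g (j %/ N) (f (j %% N) x).

Let outer (z : nat * P) : nat * Q := (z.1 %/ N, f (z.1 %% N) z.2)%N.
Let inner (z : nat * P) : nat * P := (z.1 %% N, z.2)%N.

Lemma nested_moment_hom : moment_hom nested.
Proof.
split=> [l|l x]; last by rewrite /nested gh.2 fh.2.
have [fl fm fs] := fh.1 (l %% N)%N; have [gl gm gs] := gh.1 (l %/ N)%N.
by split=> [a x y|x y|x]; rewrite /nested ?fl ?gl ?fm ?gm ?fs ?gs.
Qed.

Lemma wordval_outer w : wordval nested w = wordval g (map outer w).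
Proof. by rewrite /wordval big_map. Qed.

(** A run inside one outer copy becomes a single letter for [g]. The empty run is excluded because
    [g a] need not preserve 1. *)
Lemma wordval_inner a r : all (fun z => z.1 %/ N == a)%N r -> r <> [::] ->
  wordval nested r = g a (wordval f (map inner r)).
Proof.
move=> ra r0; rewrite /wordval big_map.
case: r r0 ra => // z r _ ra.
rewrite -(big_map (fun z => f (z.1 %% N)%N z.2) xpredT id) /= -moment_hom_prod//.
rewrite -map_cons big_map big_seq [RHS]big_seq; apply: eq_bigr => y yr.
by rewrite /nested (eqP (allP ra _ yr)).
Qed.

(** With equal quotients by [N], distinct labels have distinct remainders. *)
Lemma alternate_inner a r : all (fun z => z.1 %/ N == a)%N r ->
  alternate r -> alternate (map inner r).
Proof.
move=> ra; rewrite /alternate sorted_map; apply: sub_in_sorted ra => y z.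
move=> /eqP ya /eqP za /=; apply: contra => /eqP yz.
by rewrite (divn_eq y.1 N) (divn_eq z.1 N) ya za yz.
Qed.

(** Cut the word into maximal runs of constant quotient; maximality is what makes the list of runs
    alternate. *)
Lemma alternate_runs w : alternate w -> exists rs : seq (nat * seq (nat * P)),
  [/\ w = flatten [seq r.2 | r <- rs], alternate rs &
      forall r, r \in rs ->
        [/\ all (fun z => z.1 %/ N == r.1)%N r.2, r.2 <> [::] & alternate r.2]].
Proof.
elim: w => [_|z w IH zw]; first by exists [::].
have [|rs [wE rsa rsP]] := IH; first exact: (@alternate_catr _ _ [:: z]).
case: rs wE rsa rsP => [|[a r] rs] wE rsa rsP.
  exists [:: (z.1 %/ N, [:: z])%N]; rewrite wE; split=> // r; rewrite inE => /eqP ->.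
  by split=> //=; rewrite eqxx.
have [/= ra r0 ar] := rsP (a, r) (mem_head _ _).
have [za|za] := eqVneq (z.1 %/ N)%N a.
  exists ((a, z :: r) :: rs); split; first by rewrite wE.
    by move: rsa; rewrite /alternate; case: (rs).
  move=> s; rewrite inE => /orP[/eqP ->|srs]; last by apply: rsP; rewrite inE srs orbT.
  split=> //=; first by rewrite za eqxx.
  by move: zw; rewrite wE; exact: (@alternate_catl _ _ (z :: r)).
exists ((z.1 %/ N, [:: z])%N :: (a, r) :: rs); split; first by rewrite wE.
  by rewrite /alternate /= za.
move=> s; rewrite inE => /orP[/eqP ->|/rsP//].
by split=> //=; rewrite eqxx.
Qed.

Lemma wordval_runs (rs : seq (nat * seq (nat * P))) :
  (forall r, r \in rs -> all (fun z => z.1 %/ N == r.1)%N r.2 /\ r.2 <> [::]) ->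
  wordval nested (flatten [seq r.2 | r <- rs]) =
  wordval g [seq (r.1, wordval f (map inner r.2)) | r <- rs].
Proof.
elim: rs => [|r rs IH] rsP; first by rewrite !wordval_nil.
rewrite /= wordval_cat wordval_cons IH => [|s srs]; last by apply: rsP; rewrite inE srs orbT.
by have [ra r0] := rsP r (mem_head _ _); rewrite (wordval_inner ra r0).
Qed.

(** The product over labels below [A * N] is a double product over quotient and remainder: the outer
    rule yields the first, the inner rule the second. *)
Lemma nested_tensor : tensor_words f -> tensor_words g -> tensor_words nested.
Proof.
move=> tf tg w s _ us sub.
(* All labels are below [A], hence below [A * N] as [N] is positive; the list [s] may thus be
   replaced by a full interval. *)
have [A sA] : exists A, forall l, l \in s -> (l < A)%N.
  by exists (\sum_(l <- s) l).+1 => l ls; rewrite ltnS (big_rem l)//= leq_addr.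
have supp l : l \notin s -> state P (\prod_(z <- w | z.1 == l) z.2) = 1.
  move=> ls; rewrite big1_seq ?state1// => z /andP[/eqP zl zw].
  by rewrite -zl sub ?map_f in ls.
rewrite (@prod_seq_support _ _ s (index_iota 0 (A * N)))// ?iota_uniq//; last first.
  move=> l; rewrite mem_index_iota /= => lA; apply: supp; apply: contra lA => /sA lA.
  by rewrite (leq_trans lA)// leq_pmulr.
rewrite big_nat_mul wordval_outer (tensor_words_gen gh tg (s := index_iota 0 A)) ?iota_uniq//.
  apply: eq_bigr => a _; rewrite big_map mulSn addnC.
  rewrite -[in RHS](add0n (a * N)%N) big_addn addnC addnK.
  transitivity (state Q (wordval f (map inner [seq z <- w | z.1 %/ N == a]%N))).
    by rewrite /wordval big_map big_filter.
  rewrite (tensor_words_gen fh tf (s := index_iota 0 N)) ?iota_uniq//.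
    apply: eq_big_nat => b /= bN; congr (state P _); rewrite big_map big_filter_cond.
    apply: eq_bigl => z /=; apply/andP/eqP => [[/eqP <- /eqP <-]|->].
      by rewrite addnC -divn_eq.
    by rewrite addnC divnMDl// divn_small// addn0 modnMDl modn_small.
  by move=> l /mapP[_ /mapP[z _ ->] ->]; rewrite mem_index_iota /= ltn_mod.
move=> l /mapP[_ /mapP[z zw ->] ->]; rewrite mem_index_iota /=.
by rewrite (leq_ltn_trans (leq_div _ _))// sA// sub// map_f.
Qed.

(** By the inner rule every run of centred letters is itself centred; the runs alternate, so the
    outer rule gives 0. *)
Lemma nested_free : free_words f -> free_words g -> free_words nested.
Proof.
move=> [f1 ff] [g1 fg]; split=> [l|w aw w0 wc]; first by rewrite /nested f1.
have [rs [wE rsa rsP]] := alternate_runs aw.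
rewrite wE wordval_runs => [|r /rsP[]//].
apply: fg.
- by rewrite /alternate sorted_map.
- by move=> rs0; apply: w0; rewrite wE; case: (rs) rs0.
- move=> _ /mapP[r rrs ->] /=; have [ra r0 ar] := rsP r rrs.
  apply: ff; first exact: alternate_inner ra ar.
    by case: (r.2) r0.
  move=> _ /mapP[z zr ->] /=; apply: wc; rewrite wE.
  by apply/flattenP; exists r.2 => //; exact: map_f.
Qed.

Lemma nested_boolean : boolean_words f -> boolean_words g -> boolean_words nested.
Proof.
move=> bf bg w aw; have [rs [wE rsa rsP]] := alternate_runs aw.
rewrite wE wordval_runs => [|r /rsP[]//].
rewrite bg; last by rewrite /alternate sorted_map.
rewrite big_map big_flatten big_map big_seq [RHS]big_seq; apply: eq_bigr => r rrs.
by have [ra r0 ar] := rsP r rrs; rewrite bf ?big_map//; exact: alternate_inner ra ar.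
Qed.

(** The peak sits in a run [u2 x v1] of the outer copy [a], whose index is maximal. The outer rule
    extracts the whole run, the inner rule removes x from it, and the outer rule read backwards
    reinserts the rest. *)
Lemma nested_monotone : monotone_words f -> monotone_words g -> monotone_words nested.
Proof.
move=> mf mg u l x v aw allw; set a := (l %/ N)%N.
have [u1 [u2 [uE u2a u1a]]] := span_suffix (fun z => z.1 %/ N == a)%N u.
have [v1 [v2 [vE v1a v2a]]] := span_prefix (fun z => z.1 %/ N == a)%N v.
have le_a : all (fun z => z.1 %/ N <= a)%N (u ++ v).
  by apply: sub_all allw => z zl; exact: leq_div2r.
(* Applied to the run with and without the peak; in the second case the run can be empty. *)
have run s : all (fun z => z.1 %/ N == a)%N s ->
    state R (wordval nested (u1 ++ s ++ v2)) =
    state Q (wordval f (map inner s)) * state R (wordval nested (u1 ++ v2)).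
  move=> sa; have [->|/eqP s0] := eqVneq s [::]; first by rewrite wordval_nil state1 mul1r.
  rewrite !wordval_cat (wordval_inner sa s0) -!wordval_cat !wordval_outer.
  rewrite -(wordval_cons g (a, wordval f (map inner s))) -wordval_cat.
  rewrite (monotone_words_gen gh mg) ?map_cat//.
  - rewrite -map_cat all_map; move: le_a; rewrite uE vE !all_cat.
    by move=> /andP[/andP[-> _] /andP[_ ->]].
  - move: le_a u1a; rewrite uE vE !all_cat -andbA => /and4P[+ _ _ _].
    case/lastP: (u1) => // r z; rewrite all_rcons !map_rcons !last_rcons => /andP[le_a _] /=.
    by rewrite ltEnat /= ltn_neqAle le_a andbT.
  - move: le_a v2a; rewrite uE vE !all_cat -andbA => /and4P[_ _ _ +].
    case: (v2) => //= z r /andP[le_a _].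
    by rewrite ltEnat /= ltn_neqAle le_a andbT.
have -> : u ++ (l, x) :: v = u1 ++ (u2 ++ (l, x) :: v1) ++ v2.
  by rewrite uE vE -!catA.
have -> : u ++ v = u1 ++ (u2 ++ v1) ++ v2 by rewrite uE vE -!catA.
have sa : all (fun z => z.1 %/ N == a)%N (u2 ++ (l, x) :: v1).
  by rewrite all_cat /= u2a v1a eqxx.
rewrite (run _ sa) (run (u2 ++ v1)) ?all_cat ?u2a// mulrA !map_cat.
rewrite map_cons mf//.
  rewrite -[_ ++ _ :: _](map_cat inner u2 ((l, x) :: v1)); apply: (alternate_inner sa).
  move: aw; rewrite uE vE -catA => /alternate_catr.
  by rewrite -cat_cons catA => /alternate_catl.
rewrite -map_cat all_map; apply/allP => z zuv.
have za : (z.1 %/ N == a)%N.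
  by move: zuv; rewrite mem_cat => /orP[/(allP u2a)|/(allP v1a)].
have : (z.1 <= l)%N.
  apply: (allP allw); rewrite uE vE !mem_cat.
  by move: zuv; rewrite mem_cat => /orP[] ->; rewrite ?orbT.
by rewrite /= leEnat {1}(divn_eq z.1 N) {1}(divn_eq l N) (eqP za) leq_add2l.
Qed.

Lemma nested_words_independent k :
  words_independent k f -> words_independent k g -> words_independent k nested.
Proof.
case: k; [exact: nested_tensor|exact: nested_free|exact: nested_boolean|exact: nested_monotone].
Qed.

End Associativity.

(** * Binomials as polynomials, and linear coefficients *)

Lemma binomial_poly (F : numFieldType) k :
  exists p : {poly F}, forall N, p.[N%:R] = 'C(N, k)%:R.
Proof.
have [q qE] : exists q : {poly F}, forall N, q.[N%:R] = (N ^_ k)%:R.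
  elim: k => [|k [q qE]]; first by exists 1 => N; rewrite hornerE ffactn0.
  exists (q * ('X - k%:R%:P)) => N; rewrite !hornerE qE ffactnSr natrM.
  (* For N below k the truncated difference is not the value of the linear factor, but the falling
     factorial already vanishes. *)
  have [kN|Nk] := leqP k N; first by rewrite natrB.
  by rewrite ffact_small// !mul0r.
exists ((k`!)%:R^-1 *: q) => N; rewrite hornerZ qE -bin_ffact natrM mulrC mulfK//.
by rewrite pnatr_eq0 -lt0n fact_gt0.
Qed.

(** The linear coefficient is the derivative at 0, so this is the chain rule. *)
Lemma coef1_comp_scaleX (F : comNzRingType) (p : {poly F}) (a : F) :
  (p \Po (a *: 'X))`_1 = a * p`_1.
Proof.
have coef1 (q : {poly F}) : q`_1 = q^`().[0] by rewrite horner_coef0 coef_deriv.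
rewrite !coef1 deriv_comp hornerM horner_comp derivZ derivX.
by rewrite !hornerZ hornerX -polyC1 hornerC mulr0 mulr1 mulrC.
Qed.

(** * Polynomiality and iteration of dot moments *)

Section DotMoment.
Variables (C : numClosedFieldType).

Lemma moment_hom_sum (P Q : algProbSpace C) (I : Type) (f : I -> P -> Q) :
  moment_hom f -> forall l N (F : 'I_N -> P), f l (\sum_(b < N) F b) = \sum_(b < N) f l (F b).
Proof.
move=> fh l N F; have fB := moment_homB fh l.
apply: (big_morph (f l)) => [x y|]; first by have := fB 1 x y; rewrite !scale1r.
by have := fB (-1) 0 0; rewrite scaler0 addr0 scaleN1r addNr.
Qed.

Lemma moment_unique (P Q Q' : algProbSpace C) k d (I : orderType d)
    (f : I -> P -> Q) (g : I -> P -> Q') :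
  moment_hom f -> moment_hom g -> words_independent k f -> words_independent k g ->
  forall n (X : 'I_n -> P) (l : 'I_n -> I),
  state Q (\prod_i f (l i) (X i)) = state Q' (\prod_i g (l i) (X i)).
Proof.
move=> fh gh kf kg n X l.
have := words_independent_unique fh gh kf kg [seq (l i, X i) | i <- index_enum 'I_n].
by rewrite /wordval !big_map.
Qed.

Variables (k : independence) (P : algProbSpace C) (c : copies k P).

Lemma dot_momentE n (X : 'I_n -> P) N : dot_moment c X N =
  \sum_(j : {ffun 'I_n -> 'I_N}) state (copy_space c) (\prod_i copy c (j i) (X i)).
Proof. by rewrite /dot_moment bigA_distr_bigA linear_sum. Qed.

(** Restricting the copies along [h] and along the inclusion of ['I_m] in the naturals gives two
    families obeying the rule, and uniqueness applies. So only the order type of the labels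
    matters. *)
Lemma copy_moment_mono n (X : 'I_n -> P) m N (h : 'I_m -> 'I_N) (l : 'I_n -> 'I_m) :
  {mono h : i j / (i <= j)%O} ->
  state (copy_space c) (\prod_i copy c (h (l i)) (X i)) =
  state (copy_space c) (\prod_i copy c (l i) (X i)).
Proof.
move=> hm; have cw := copies_words_independent c; have [c1 c2] := copy_moment_hom c.
apply: (moment_unique (k := k) (f := fun i => copy c (h i))
  (g := fun i => copy c i)) => //; try by split.
- by apply: (words_independent_pullback (h := fun i => h i : nat)) => // i j; rewrite -hm.
- by apply: (words_independent_pullback (h := fun i : 'I_m => i : nat)).
Qed.

(** Sum over the labellings that use all m labels; it will be the coefficient of the binomial C(N,
    m). *)
Definition surj_moment n (X : 'I_n -> P) (m : nat) : C :=
  \sum_(j : {ffun 'I_n -> 'I_m} | j @: 'I_n == [set: 'I_m]%SET)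
    state (copy_space c) (\prod_i copy c (j i) (X i)).

Lemma surj_moment0 n (X : 'I_n -> P) m : (n < m)%N -> surj_moment X m = 0.
Proof.
move=> nm; rewrite /surj_moment big1// => j /eqP jT.
by have := leq_imset_card j 'I_n; rewrite jT cardsT !card_ord leqNgt nm.
Qed.

(** The increasing enumeration [h] of [S] turns surjections onto ['I_#|S|] into the labellings with
    image [S], without changing the order type. *)
Lemma dot_moment_image n (X : 'I_n -> P) N (S : {set 'I_N}) :
  \sum_(j : {ffun 'I_n -> 'I_N} | j @: 'I_n == S)
    state (copy_space c) (\prod_i copy c (j i) (X i)) = surj_moment X #|S|.
Proof.
pose h : 'I_#|S| -> 'I_N := @Order.enum_val _ _ (mem S).
have hm : {mono h : i j / (i <= j)%O} by apply: Order.EnumVal.le_enum_val; exact: le_total.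
have hS i : h i \in S by exact: Order.EnumVal.enum_valP.
have Sh x : x \in S -> exists i, x = h i.
  move=> xS; exists (Order.enum_rank_in xS x).
  by rewrite /h Order.EnumVal.enum_rankK_in.
pose H (j : {ffun 'I_n -> 'I_#|S|}) : {ffun 'I_n -> 'I_N} := [ffun i => h (j i)].
have Hi : injective H.
  by move=> j j' /ffunP jj'; apply/ffunP => i; have := jj' i; rewrite !ffunE => /(inc_inj hm).
pose J := [set j : {ffun 'I_n -> 'I_#|S|} | j @: 'I_n == [set: 'I_#|S|]%SET]%SET.
transitivity (\sum_(j in H @: J)
    state (copy_space c) (\prod_i copy c (j i) (X i))).
  apply: eq_bigl => j; apply/eqP/imsetP => [jS|[j' + ->]].
    have /fin_all_exists[j' jj'] i : exists k, j i = h k.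
      by apply: Sh; rewrite -jS imset_f.
    exists (finfun j'); last by apply/ffunP => i; rewrite !ffunE.
    rewrite inE; apply/eqP/setP => y; rewrite !inE.
    have /imsetP[i _] : h y \in j @: 'I_n by rewrite jS.
    rewrite jj' => /(inc_inj hm) ->.
    by apply/imsetP; exists i; rewrite ?ffunE.
  rewrite inE => /eqP jT; apply/setP => y; apply/imsetP/idP => [[i _ ->]|/Sh[m ->]].
    by rewrite ffunE.
  have : m \in j' @: 'I_n by rewrite jT inE.
  by move=> /imsetP[i _ ->]; exists i; rewrite ?ffunE.
rewrite big_imset /=; last by move=> ? ? _ _; exact: Hi.
rewrite /surj_moment; apply: eq_big => [j|j _]; first by rewrite inE.
rewrite -(copy_moment_mono X j hm); congr (state _ _).
by apply: eq_bigr => i _; rewrite ffunE.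
Qed.

Lemma dot_moment_binomial n (X : 'I_n -> P) N :
  dot_moment c X N = \sum_(m < n.+1) 'C(N, m)%:R * surj_moment X m.
Proof.
rewrite dot_momentE (partition_big (fun j : {ffun _} => j @: 'I_n) xpredT)//=.
under eq_bigr do rewrite dot_moment_image.
(* Sort the images by cardinality m; sizes above n admit no surjection, and C(N, m) sets have size
   m. *)
transitivity (\sum_(S : {set 'I_N}) \sum_(m < n.+1 | #|S| == m) surj_moment X m).
  apply: eq_bigr => S _; have [Sn|nS] := leqP #|S| n.
    by rewrite (big_pred1 (inord #|S|)) ?inordK// => m; rewrite /= -[RHS]val_eqE /= inordK// eq_sym.
  rewrite surj_moment0// big_pred0// => m; apply/negP => /eqP Sm.
  by move: nS; rewrite Sm ltnNge -ltnS ltn_ord.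
rewrite (exchange_big_dep xpredT)//=; apply: eq_bigr => m _.
by rewrite sumr_const -cardsE card_draws card_ord mulr_natl.
Qed.

Lemma dot_moment_polyP n (X : 'I_n -> P) : exists p, dot_moment_poly c X p.
Proof.
have /fin_all_exists[b bE] (m : 'I_n.+1) := binomial_poly C m.
exists (\sum_(m < n.+1) surj_moment X m *: b m) => N.
rewrite dot_moment_binomial horner_sum; apply: eq_bigr => m _.
by rewrite hornerZ bE mulrC.
Qed.

Lemma dot_moment_dot (c' : copies k (copy_space c)) n (X : 'I_n -> P) N M : (0 < n)%N ->
  dot_moment c' (fun i => dot c N (X i)) M = dot_moment c X (M * N).
Proof.
move=> n_gt0; rewrite dot_momentE.
have dotE i : dot c' M (dot c N (X i)) =
    \sum_(j < M * N) nested (copy c) (copy c') N j (X i).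
  rewrite -(big_mkord xpredT (fun j => nested (copy c) (copy c') N j (X i))).
  (* Labels are written j = a N + b, with a the outer and b the inner copy. *)
  rewrite big_nat_mul big_mkord /dot; apply: eq_bigr => a _.
  rewrite (moment_hom_sum (copy_moment_hom c')) mulSn addnC.
  rewrite -[in RHS](add0n (a * N)%N) big_addn addnC addnK big_mkord.
  apply: eq_bigr => b _; have N_gt0 : (0 < N)%N by exact: leq_ltn_trans (ltn_ord b).
  by rewrite /nested addnC divnMDl// modnMDl divn_small// modn_small// addn0.
rewrite /dot_moment; under eq_bigr do rewrite dotE.
rewrite bigA_distr_bigA linear_sum; apply: eq_bigr => j _.
(* As n is positive, the labelling [j] has a value below [M * N], which forces N to be positive. *)
have N_gt0 : (0 < N)%N.
  by have := leq_ltn_trans (leq0n _) (ltn_ord (j (Ordinal n_gt0))); rewrite muln_gt0 => /andP[].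
apply: (moment_unique (k := k)).
- exact: nested_moment_hom (copy_moment_hom c) (copy_moment_hom c').
- exact: copy_moment_hom.
- apply: nested_words_independent => //; try exact: copy_moment_hom;
    exact: copies_words_independent.
- exact: copies_words_independent.
Qed.

End DotMoment.

Theorem proposition3p4 (R : realType) (k : independence) (P : algProbSpace R[i])
    (c : copies k P) (c' : copies k (copy_space c))
    (n : nat) (X : 'I_n -> P) (N : nat) :
  (1 <= n)%N ->
  [/\ exists p, dot_moment_poly c X p,
      exists p, dot_moment_poly c' (fun i => dot c N (X i)) p
    & cumulant c' (fun i => dot c N (X i)) = N%:R * cumulant c X].
Proof.
move=> n_gt0; have [p pE] := dot_moment_polyP c X.
(* The composite takes at M the value of [p] at N M, the moment of the (M N)-fold dot. *)
have qE : dot_moment_poly c' (fun i => dot c N (X i)) (p \Po (N%:R *: 'X)).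
  by move=> M; rewrite dot_moment_dot// pE horner_comp hornerZ hornerX natrM mulrC.
split; [by exists p | by exists (p \Po (N%:R *: 'X)) |].
by rewrite (cumulantE qE) (cumulantE pE) coef1_comp_scaleX.
Qed.
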